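(* Let $\psi\not\equiv0$ be a smooth non-negative function compactly supported in $(0,1)$ (extended by $0$ to $\mathbb{R}$), and let $\eta=\eta_\psi$ be the associated function defined in the context. Then for all $s>0$ $$\eta(s)=\frac1{2s^3}\int_{\frac s2-1}^{s-1}\psi(t)\,dt.$$ In particular, $\eta$ is non-negative.
   Context: Given $\psi$, define for $s>0$ $$\varphi(s)=s^{-3}\Big[\tfrac12\psi\Big(\frac1{2s}-1\Big)-\psi\Big(\frac1s-1\Big)\Big],\qquad \Theta(s)=-6s^{-5}\varphi\Big(\frac1s\Big)-2s^{-6}\varphi'\Big(\frac1s\Big),$$ $$\chi'(s)=s^{-2}\int_0^st^2\Theta(t)\,dt,\qquad \eta_\psi(s)=-\tfrac12s^{-5}\varphi\Big(\frac1s\Big)+\tfrac14s^{-1}\chi'(s).$$ (This $\eta_\psi\in C_c^\infty((1,4))$ is the weight function appearing in the paper's formula expressing the harmonic mass through the metric coefficients near infinity.) *)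

(* Defs.v *)
(* Stdlib reals with Coquelicot. *)
From Stdlib Require Import Reals.
From Coquelicot Require Import Coquelicot.
Open Scope R_scope.

Definition smooth (f : R -> R) : Prop :=
  forall (n : nat) (x : R), ex_derive_n f n x.

(* The closed support is a compact subset of the open interval (a, b): it is
   contained in some segment [c, d] with a < c and d < b. *)
Definition compactly_supported_in (f : R -> R) (a b : R) : Prop :=
  exists c d : R, a < c /\ d < b /\ forall x : R, f x <> 0 -> c <= x <= d.

(* The functions below are meaningful for s > 0 only; their values at s <= 0 are
   artefacts of totality.  In particular [dchi] integrates [Theta] from 0, and
   [RInt] does not depend on the value of the integrand at that endpoint. *)

Definition phi (psi : R -> R) (s : R) : R :=
  / s ^ 3 * (1 / 2 * psi (1 / (2 * s) - 1) - psi (1 / s - 1)).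

Definition Theta (psi : R -> R) (s : R) : R :=
  - 6 * / s ^ 5 * phi psi (1 / s) - 2 * / s ^ 6 * Derive (phi psi) (1 / s).

(* The derivative chi' of chi; chi itself is not needed. *)
Definition dchi (psi : R -> R) (s : R) : R :=
  / s ^ 2 * RInt (fun t : R => t ^ 2 * Theta psi t) 0 s.

Definition eta (psi : R -> R) (s : R) : R :=
  - (1 / 2) * / s ^ 5 * phi psi (1 / s) + 1 / 4 * / s * dchi psi s.

(* Main.v *)
Require Import Defs.
From Stdlib Require Import Reals Lra.
From Coquelicot Require Import Coquelicot.
Open Scope R_scope.

(** Put [g t = psi (t / 2 - 1) / 2 - psi (t - 1)], so that
    [phi psi (1 / t) = t ^ 3 * g t].  The inversion [t -> 1 / t] turns the two
    terms of [Theta psi t] into multiples of [g t] and [g' t]; the multiples of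
    [g t] cancel and leave [t ^ 2 * Theta psi t = 2 * t * g' t]
    ([Theta_profile]).  Integrating by parts, the integral of this from [0] to
    [s] is [2 * s * g s] minus twice the integral of [g].  By the substitutions
    [t / 2 - 1] and [t - 1], the integral of [g] is minus the integral [I] of
    [psi] over the window from [s / 2 - 1] to [s - 1]: the two substituted
    integrals start at the same point [-1] ([RInt_Theta]).  Hence
    [dchi psi s = (2 * s * g s + 2 * I) / s ^ 2], and in [eta psi s] the terms
    in [g s] cancel, leaving [I / (2 * s ^ 3)].  Non-negativity follows because
    [s / 2 - 1 <= s - 1] for [s > 0]. *)

Definition profile (psi : R -> R) (t : R) : R :=
  1 / 2 * psi (t / 2 - 1) - psi (t - 1).

Definition dprofile (psi : R -> R) (t : R) : R :=
  1 / 4 * Derive psi (t / 2 - 1) - Derive psi (t - 1).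

Lemma phi_inv (psi : R -> R) (t : R) :
  0 < t -> phi psi (1 / t) = t ^ 3 * profile psi t.
Proof.
intros Ht; unfold phi, profile.
replace (1 / (2 * (1 / t)) - 1) with (t / 2 - 1) by (field; lra).
replace (1 / (1 / t) - 1) with (t - 1) by (field; lra).
field; lra.
Qed.

Lemma Derive_phi_inv (psi : R -> R) (t : R) :
  (forall x, ex_derive psi x) -> 0 < t ->
  Derive (phi psi) (1 / t) =
    - 3 * t ^ 4 * profile psi t - t ^ 5 * dprofile psi t.
Proof.
intros Hd Ht.
assert (Hu : 0 < 1 / t) by (apply Rdiv_lt_0_compat; lra).
apply is_derive_unique; unfold phi.
auto_derive.
- assert (Hp : 1 / t * (1 / t * (1 / t * 1)) <> 0).
  { repeat apply Rmult_integral_contrapositive_currified; lra. }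
  repeat split; auto; lra.
- unfold profile, dprofile.
  replace (1 * / (2 * (1 / t)) + - (1)) with (t / 2 - 1) by (field; lra).
  replace (1 * / (1 / t) + - (1)) with (t - 1) by (field; lra).
  change (Derive (fun x => psi x)) with (Derive psi).
  field; lra.
Qed.

Lemma Theta_profile (psi : R -> R) (t : R) :
  (forall x, ex_derive psi x) -> 0 < t ->
  t ^ 2 * Theta psi t = 2 * t * dprofile psi t.
Proof.
intros Hd Ht; unfold Theta.
rewrite phi_inv, Derive_phi_inv by assumption.
field; lra.
Qed.

Lemma ex_RInt_of_continuous (f : R -> R) (a b : R) :
  (forall x, continuous f x) -> ex_RInt f a b.
Proof. intros Hf; apply (ex_RInt_continuous f); intros; apply Hf. Qed.

Lemma is_derive_RInt_upper (f : R -> R) (a x : R) :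
  (forall y, continuous f y) -> is_derive (RInt f a) x (f x).
Proof.
intros Hf; apply (is_derive_RInt f (RInt f a) a); [|apply Hf].
apply filter_forall; intros y.
apply (RInt_correct f), ex_RInt_of_continuous, Hf.
Qed.

(** An antiderivative of [2 * t * dprofile psi t], found by integrating by
    parts: [P (t - 1) - P (t / 2 - 1)], with [P] a primitive of [psi], is an
    antiderivative of [- profile psi]. *)
Lemma is_derive_primitive (psi : R -> R) (t : R) :
  (forall x, ex_derive psi x) ->
  is_derive
    (fun t => 2 * t * profile psi t
              + 2 * (RInt psi 0 (t - 1) - RInt psi 0 (t / 2 - 1)))
    t (2 * t * dprofile psi t).
Proof.
intros Hd.
assert (Hc : forall x, continuous psi x)
  by (intros x; apply (ex_derive_continuous psi), Hd).
assert (HP : forall x, is_derive (RInt psi 0) x (psi x))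
  by (intros x; apply is_derive_RInt_upper, Hc).
(* Naming the primitive makes [auto_derive] treat it as an arbitrary
   differentiable function. *)
revert HP; generalize (RInt psi 0); intros P HP.
assert (HdP : forall x, ex_derive P x) by (intros x; eexists; apply HP).
unfold profile, dprofile; auto_derive; [repeat split; auto|].
change (Derive (fun x => psi x)) with (Derive psi).
change (Derive (fun x => P x)) with (Derive P).
rewrite !(is_derive_unique P _ _ (HP _)).
unfold Rdiv, Rminus; field.
Qed.

Lemma continuous_mul_dprofile (psi : R -> R) (t : R) :
  (forall x, ex_derive (Derive psi) x) ->
  continuous (fun t => 2 * t * dprofile psi t) t.
Proof.
intros Hd; apply (ex_derive_continuous (fun t => 2 * t * dprofile psi t)).
unfold dprofile; auto_derive; repeat split; apply Hd.
Qed.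

Lemma RInt_Theta (psi : R -> R) (s : R) :
  (forall x, ex_derive psi x) -> (forall x, ex_derive (Derive psi) x) ->
  0 < s ->
  RInt (fun t => t ^ 2 * Theta psi t) 0 s =
    2 * s * profile psi s + 2 * RInt psi (s / 2 - 1) (s - 1).
Proof.
intros Hd Hd2 Hs.
rewrite (RInt_ext _ (fun t => 2 * t * dprofile psi t)).
2:{ intros t; rewrite Rmin_left by lra; intros [Ht _].
    now apply Theta_profile. }
assert (Hw : RInt psi 0 (s / 2 - 1) + RInt psi (s / 2 - 1) (s - 1)
             = RInt psi 0 (s - 1)).
{ apply (RInt_Chasles psi); apply ex_RInt_of_continuous; intros x;
    apply (ex_derive_continuous psi), Hd. }
etransitivity.
{ apply is_RInt_unique, is_RInt_derive.
  - intros t _; now apply is_derive_primitive.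
  - intros t _; now apply continuous_mul_dprofile. }
unfold minus, plus, opp; simpl.
(* At [0] both ends of the window equal [-1]. *)
replace (0 / 2 - 1) with (0 - 1) by field.
rewrite <- Hw; ring.
Qed.

Theorem proposition51 (psi : R -> R)
  (psi_neq0 : exists x : R, psi x <> 0)
  (psi_smooth : smooth psi)
  (psi_ge0 : forall x : R, 0 <= psi x)
  (psi_supp : compactly_supported_in psi 0 1) :
  (forall s : R, 0 < s ->
     eta psi s = 1 / (2 * s ^ 3) * RInt psi (s / 2 - 1) (s - 1)) /\
  (forall s : R, 0 < s -> 0 <= eta psi s).
Proof.
assert (Hd : forall x, ex_derive psi x) by exact (psi_smooth 1%nat).
assert (Hd2 : forall x, ex_derive (Derive psi) x) by exact (psi_smooth 2%nat).
assert (Heta : forall s : R, 0 < s ->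
     eta psi s = 1 / (2 * s ^ 3) * RInt psi (s / 2 - 1) (s - 1)).
{ intros s Hs; unfold eta, dchi.
  rewrite phi_inv, RInt_Theta by assumption.
  field; lra. }
split; [exact Heta|].
intros s Hs; rewrite Heta by assumption.
apply Rmult_le_pos.
- apply Rlt_le, Rdiv_lt_0_compat; [lra|].
  apply Rmult_lt_0_compat; [lra | now apply pow_lt].
- apply RInt_ge_0; [lra | | intros; apply psi_ge0].
  apply ex_RInt_of_continuous; intros x.
  apply (ex_derive_continuous psi), Hd.
Qed.
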